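(* Let $\{X_\ell,f_\ell\}_{\ell=1}^{\infty}$ and $\{Y_\ell,g_\ell\}_{\ell=1}^{\infty}$ be inverse sequences of compact metric spaces and surjective continuous bonding functions. The following statements are equivalent. 1. There is a continuous surjection from $\varprojlim\{X_\ell,f_\ell\}_{\ell=1}^{\infty}$ to $\varprojlim\{Y_\ell,g_\ell\}_{\ell=1}^{\infty}$. 2. There are sequences $(n_\ell)$ and $(m_\ell)$ of positive integers such that $m_{k+1}\ge m_k$, $n_{k+1}>n_k$ and $m_k\ge n_k$ for each positive integer $k$, and there is a sequence $(H_\ell)$ of upper semicontinuous functions $H_\ell:X_{m_\ell}\multimap Y_{n_\ell}$ such that (a) the graph $\Gamma(H_k)$ is surjective for each positive integer $k$, (b) for each positive integer $k$ and each $j\in\{1,2,\ldots,n_k\}$, $g_{j,n_r}(H_r(x))\subseteq g_{j,n_k}(H_k(f_{m_k,m_r}(x)))$ holds for each positive integer $r>k$ and for each $x\in X_{m_r}$, (c) for each positive integer $j$, $\lim_{k\to\infty}\operatorname{diam}(g_{j,n_k}(H_k(p_{m_k}(\mathbf x))))=0$ for any $\mathbf x\in\varprojlim\{X_\ell,f_\ell\}_{\ell=1}^{\infty}$.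
   Context: For compact metric spaces $X,Y$, a set-valued function $F:X\multimap Y$ is a function from $X$ to the set $2^Y$ of non-empty closed subsets of $Y$; it is upper semicontinuous if for each open $V\subseteq Y$ the set $\{x\in X\mid F(x)\subseteq V\}$ is open in $X$. Its graph $\Gamma(F)=\{(x,y)\in X\times Y\mid y\in F(x)\}$ is called surjective if $\bigcup_{x\in X}F(x)=Y$. For continuous maps $f_\ell:X_{\ell+1}\to X_\ell$ between compact metric spaces, $\varprojlim\{X_\ell,f_\ell\}_{\ell=1}^\infty$ is the subspace of $\prod_{\ell=1}^\infty X_\ell$ of all $(x_1,x_2,\ldots)$ with $x_\ell=f_\ell(x_{\ell+1})$ for all $\ell$; similarly for $\{Y_\ell,g_\ell\}$ with $g_\ell:Y_{\ell+1}\to Y_\ell$. $p_n$ is the $n$-th coordinate projection of $\varprojlim\{X_\ell,f_\ell\}_{\ell=1}^\infty$. For $n<m$, $f_{n,m}=f_n\circ\cdots\circ f_{m-1}:X_m\to X_n$, and $f_{n,n}$ is the identity; $g_{n,m}$ is defined analogously. In the limit in (c), $k$ ranges over those $k$ with $n_k\ge j$ (all sufficiently large $k$). *)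

(* Defs.v *)
From mathcomp Require Import all_boot all_order all_algebra.
From mathcomp Require Import all_classical all_reals all_analysis.

Set Implicit Arguments.
Unset Strict Implicit.
Unset Printing Implicit Defensive.

Import numFieldNormedType.Exports.

Local Open Scope classical_set_scope.

Section SetValued.
Context {X Y : topologicalType}.
Implicit Type F : X -> set Y.

Definition set_valued F := forall x, F x !=set0 /\ closed (F x).

Definition upper_semicontinuous F :=
  set_valued F /\ forall V : set Y, open V -> open [set x | F x `<=` V].

Definition graph F : set (X * Y) := [set p | F p.1 p.2].

Definition surjective_graph F := \bigcup_x F x = [set: Y].

Lemma surjective_graphP F : surjective_graph F <-> snd @` graph F = [set: Y].
Proof.
rewrite /surjective_graph; suff -> : snd @` graph F = \bigcup_x F x by [].
by apply/seteqP; split=> [_ [[x y] Fxy <-]|y [x _ Fxy]]; [exists x|exists (x, y)].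
Qed.

End SetValued.

(* Extended-real valued, so that no boundedness has to be known in advance;
   the diameter of the empty set is -oo. *)
Definition diam (R : realType) (X : metricType R) (A : set X) : \bar R :=
  ereal_sup [set (mdist p.1 p.2)%:E | p in A `*` A].

Section InverseSequence.
(* Sequences are indexed from 0 instead of from 1. *)
Context {X : nat -> topologicalType} (f : forall l, X l.+1 -> X l).

Definition inverse_limit : set (prod_topology X) :=
  [set x | forall l, x l = @f l (x l.+1)].

Definition inverse_limit_proj (n : nat) (x : inverse_limit) : X n :=
  set_val x n.

Fixpoint bond_add (d n : nat) : X (d + n)%N -> X n :=
  match d return X (d + n)%N -> X n with
  | 0 => id
  | d'.+1 => fun x => @bond_add d' n (@f (d' + n)%N x)
  end.

(* f_{n,m} : X_m -> X_n; the term [ecast] is the transport along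
   m = (m - n) + n. *)
Definition bond (n m : nat) (nm : (n <= m)%N) (x : X m) : X n :=
  bond_add (ecast i (X i) (esym (subnK nm)) x).

(* f_{n,m}(A), as a total function of n and m: it is empty when m < n. *)
Definition bond_image (n m : nat) (A : set (X m)) : set (X n) :=
  [set y | exists nm : (n <= m)%N, (bond nm @` A) y].

Lemma bondnn n (nn : (n <= n)%N) x : bond nn x = x.
Proof.
rewrite /bond; move: (esym _); rewrite subnn => e.
by rewrite /= (eq_axiomK e).
Qed.

Lemma bondS n m (nm : (n <= m)%N) (nm1 : (n <= m.+1)%N) x :
  bond nm1 x = bond nm (f x).
Proof.
rewrite /bond; move: (subnK nm1) (subnK nm); rewrite subSn //.
move: (m - n)%N => d e1 e; move: x e1.
by case: _ / e => {nm nm1} x e1; rewrite (eq_axiomK e1).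
Qed.

Lemma bond_imageE n m (nm : (n <= m)%N) (A : set (X m)) :
  bond_image A = bond nm @` A.
Proof.
apply/seteqP; split=> [y [nm' ]|y Ay]; last by exists nm.
by rewrite (bool_irrelevance nm' nm).
Qed.

End InverseSequence.

Arguments bond_image {X} f n {m} A.

Lemma leq_of_leqS (u : nat -> nat) (uS : forall k, (u k <= u k.+1)%N) (k r : nat) :
  (k <= r)%N -> (u k <= u r)%N.
Proof. exact: homo_leq leqnn leq_trans uS k r. Qed.

(* Main.v *)
Require Import Defs.
From mathcomp Require Import all_boot all_order all_algebra.
From mathcomp Require Import all_classical all_reals all_analysis.

(* Given a continuous surjection h, take n_k = m_k = k and
   H_k(z) = p_k(h(p_k^-1(z))); the diameters tend to 0 because the fibers of
   p_k through a point shrink to that point. Conversely, by (b) and (c) the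
   compact sets g_{j,n_k}(H_k(p_{m_k}(x))) decrease in k to a single point,
   which is the j-th coordinate of h(x). It depends continuously on x because
   each H_k is upper semicontinuous, and h(x) = y for every x in the
   intersection over k of the decreasing closed nonempty sets
   {x | y_{n_k} in H_k(p_{m_k}(x))}. *)

Set Implicit Arguments.
Unset Strict Implicit.
Unset Printing Implicit Defensive.

Import Order.TTheory GRing.Theory Num.Theory.
Import numFieldNormedType.Exports.

Local Open Scope classical_set_scope.

(** * Compactness and closed sets *)

Lemma nested_closed_nonempty (T : topologicalType) (A : nat -> set T) :
  compact [set: T] -> (forall k, closed (A k)) -> (forall k, A k !=set0) ->
  (forall k, A k.+1 `<=` A k) -> \bigcap_k A k !=set0.
Proof.
move=> T_compact A_closed A0 AS.
have A_le k l : (k <= l)%N -> A l `<=` A k.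
  elim: l => [|l IH]; first by rewrite leqn0 => /eqP ->.
  by rewrite leq_eqVlt => /predU1P[->//|/IH]; exact: subset_trans.
(* The sets [A k] generate a proper filter; a cluster point of it lies in every [A k], as these are
   closed. *)
pose F : set_system T := filter_from [set: nat] A.
have FF : ProperFilter F.
  apply: filter_from_proper => [|k _]; last exact: A0.
  apply: filter_from_filter; first by exists 0%N.
  move=> k l _ _; exists (maxn k l) => // x Ax.
  by split; apply: A_le Ax; rewrite ?leq_maxl ?leq_maxr.
have [p [_ Fp]] := T_compact F FF filterT.
by exists p => k _; apply: A_closed => B /Fp; apply; exists k.
Qed.

Lemma closed_coincidence (T U : topologicalType) (u v : T -> U) :
  hausdorff_space U -> continuous u -> continuous v ->
  closed [set x | u x = v x].
Proof.
move=> U_hausdorff cu cv x xcl; apply: U_hausdorff => A B Aux Bvx.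
have ABx : nbhs x (u @^-1` A `&` v @^-1` B).
  by apply: filterI; [exact: cu|exact: cv].
have [y [/= uv [Auy Bvy]]] := xcl _ ABx.
by exists (u y); split=> //; rewrite uv.
Qed.

(** A proper filter on the subtype, pushed forward to [T], clusters at a point of [A]. Neighborhoods
    in the subtype are traces of those in [T], so it clusters there in the subtype too. *)
Lemma compact_set_type (T : topologicalType) (A : set T) :
  compact A -> compact [set: A].
Proof.
move=> A_compact F FF _.
have FA : (set_val @ F) A.
  by apply: (@filterS _ F _ setT) => [x _|]; [exact: set_valP|exact: filterT].
have [p [Ap Fp]] := A_compact _ (fmap_proper_filter set_val FF) FA.
exists (SigSub (mem_set Ap)); split=> // B C FB.
case=> _ [[W oW <-] /= Wp WC].
have FB' : (set_val @ F) (set_val @` B).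
  by apply: (@filterS _ F _ B) => // z Bz; exists z.
have [_ [[z Bz <-] Wz]] := Fp _ _ FB' (open_nbhs_nbhs (conj oW Wp)).
by exists z; split => //; apply: WC.
Qed.

(** * Inverse limits and their bonding maps *)

Section InverseLimit.
Context {X : nat -> topologicalType} (f : forall l, X l.+1 -> X l).

Lemma inverse_limit_eq (x y : inverse_limit f) :
  (forall n, inverse_limit_proj n x = inverse_limit_proj n y) -> x = y.
Proof. by move=> xy; apply/val_inj/functional_extensionality_dep. Qed.

Lemma inverse_limit_projS n (x : inverse_limit f) :
  f (inverse_limit_proj n.+1 x) = inverse_limit_proj n x.
Proof. by have := set_valP x; rewrite /inverse_limit /= => /(_ n). Qed.

Lemma bond_bond n m p (nm : (n <= m)%N) (mp : (m <= p)%N) (np : (n <= p)%N) x :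
  bond f nm (bond f mp x) = bond f np x.
Proof.
elim: p mp np x => [|p IH] mp np x.
  have m0 : m = 0%N by apply/eqP; rewrite -leqn0.
  by subst m; rewrite bondnn; congr bond; exact: bool_irrelevance.
have [mp1|mp'] := eqVneq m p.+1.
  by subst m; rewrite bondnn; congr bond; exact: bool_irrelevance.
have mp2 : (m <= p)%N by rewrite -ltnS ltn_neqAle mp'.
by rewrite (bondS f mp2) (bondS f (leq_trans nm mp2)); exact: IH.
Qed.

Lemma f_bond n m (nm : (n < m)%N) x : f (bond f nm x) = bond f (ltnW nm) x.
Proof. by rewrite -(bond_bond (leqnSn n) nm) (bondS f (leqnn n)) bondnn. Qed.

Lemma bond_inverse_limit_proj n m (nm : (n <= m)%N) (x : inverse_limit f) :
  bond f nm (inverse_limit_proj m x) = inverse_limit_proj n x.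
Proof.
elim: m nm => [|m IH] nm.
  have n0 : n = 0%N by apply/eqP; rewrite -leqn0.
  by subst n; rewrite bondnn.
have [nm1|nm'] := eqVneq n m.+1; first by subst n; rewrite bondnn.
have nm2 : (n <= m)%N by rewrite -ltnS ltn_neqAle nm'.
by rewrite (bondS f nm2) inverse_limit_projS.
Qed.

Lemma inverse_limit_proj_continuous n :
  continuous (@inverse_limit_proj X f n).
Proof.
move=> x; apply: (@continuous_comp _ (prod_topology X) _ set_val (proj n)).
  exact: initial_continuous.
exact: proj_continuous.
Qed.

Lemma continuous_inverse_limit (T : topologicalType)
    (h : T -> inverse_limit f) :
  (forall n, continuous (fun x => inverse_limit_proj n (h x))) -> continuous h.
Proof.
move=> ch; apply: continuous_comp_initial => x.
apply/cvg_sup => n U [_ [[W oW <-] /= Wx WU]].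
apply: (filterS WU); apply: (ch n x W); exact: open_nbhs_nbhs.
Qed.

(** A thread through [z] has the bond images of [z] as coordinates up to [n]; the later ones are
    chosen recursively as preimages under [f]. *)
Lemma inverse_limit_proj_surj :
  (forall l, set_surj [set: X l.+1] [set: X l] (@f l)) ->
  forall n (z : X n), exists x : inverse_limit f, inverse_limit_proj n x = z.
Proof.
move=> f_surj n z.
(* Above [n] this condition is vacuous, so any preimage may be chosen there. *)
pose P l (u : X l) := forall ln : (l <= n)%N, u = bond f ln z.
have step l (u : {u | P l u}) : {v : {v | P l.+1 v} | f (sval v) = sval u}.
  case: u => u Pu; apply: cid.
  have [ln|nl] := ltnP l n.
    have Pz : P l.+1 (bond f ln z).
      by move=> ln'; congr bond; exact: bool_irrelevance.
    by exists (exist _ _ Pz); rewrite /= f_bond -Pu.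
  have [v _ vu] := f_surj l u I.
  have Pv : P l.+1 v by move=> ln; move: (leq_trans ln nl); rewrite ltnn.
  by exists (exist _ v Pv).
have P0 : P 0%N (bond f (leq0n n) z).
  by move=> ln; congr bond; exact: bool_irrelevance.
pose a := nat_rect (fun l => {u | P l u}) (exist _ _ P0)
  (fun l u => sval (step l u)).
have alim : inverse_limit f (fun l => sval (a l)).
  by move=> l /=; rewrite (svalP (step l (a l))).
exists (SigSub (mem_set alim)).
by rewrite /inverse_limit_proj set_valE /= (svalP (a n) (leqnn n)) bondnn.
Qed.

Hypothesis f_continuous : forall l, continuous (@f l).

Lemma bond_continuous n m (nm : (n <= m)%N) : continuous (bond f nm).
Proof.
have bond_id k (kk : (k <= k)%N) : bond f kk = id.
  by apply/funext => y; rewrite bondnn.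
elim: m nm => [|m IH] nm.
  have n0 : n = 0%N by apply/eqP; rewrite -leqn0.
  by subst n => x; rewrite bond_id.
have [nm1|nm'] := eqVneq n m.+1; first by subst n => x; rewrite bond_id.
have nm2 : (n <= m)%N by rewrite -ltnS ltn_neqAle nm'.
rewrite (_ : bond f nm = bond f nm2 \o @f m); last first.
  by apply/funext => y; rewrite (bondS f nm2).
by move=> x; apply: continuous_comp; [exact: f_continuous|exact: IH].
Qed.

(** The limit is closed in the Tychonoff product, being an intersection of coincidence sets of
    continuous maps into Hausdorff spaces. *)
Lemma inverse_limit_compact : (forall l, hausdorff_space (X l)) ->
  (forall l, compact [set: X l]) -> compact [set: inverse_limit f].
Proof.
move=> X_hausdorff X_compact; apply: compact_set_type.
apply: (@subclosed_compact (prod_topology X) _ [set: prod_topology X]) => //.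
  rewrite (_ : inverse_limit f =
    \bigcap_l [set x : prod_topology X | x l = f (x l.+1)]); last first.
    by apply/seteqP; split=> x Hx // l => [_|]; exact: Hx.
  apply: closed_bigI => l _; apply: closed_coincidence => //.
    exact: (@proj_continuous _ X l).
  move=> x; apply: (@continuous_comp (prod_topology X) _ _ (proj l.+1)).
    exact: proj_continuous.
  exact: f_continuous.
have := @tychonoff nat X (fun=> setT) X_compact.
by congr compact; apply/seteqP; split.
Qed.

End InverseLimit.

(** * Vanishing diameters in terms of distances *)

Section Diameter.
Context {R : realType} {X : metricType R}.
Implicit Types A B : set X.
Local Open Scope ereal_scope.

Lemma mdist_le_diam A x y : A x -> A y -> (mdist x y)%:E <= diam A.
Proof. by move=> Ax Ay; apply: ereal_sup_ubound; exists (x, y). Qed.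

Lemma diam_ge0 A : A !=set0 -> 0 <= diam A.
Proof. by case=> x Ax; have := mdist_le_diam Ax Ax; rewrite mdistxx. Qed.

Lemma cvg_diam0P (A : nat -> set X) :
  diam (A k) @[k --> \oo] --> 0 ->
  forall e : R, (0 < e)%R -> \forall k \near \oo,
    forall x y, A k x -> A k y -> (mdist x y < e)%R.
Proof.
move=> A0 e e0; have : \forall k \near \oo, diam (A k) < e%:E.
  by apply: (A0 [set u | u < e%:E]); apply: open_ereal_lt'; rewrite lte_fin.
apply: filterS => k Ake x y Ax Ay; rewrite -lte_fin.
exact: le_lt_trans (mdist_le_diam Ax Ay) Ake.
Qed.

(** Eventual nonemptiness bounds the diameters below by 0, since the empty set has diameter [-oo].
    The bound [<= e] is non-strict because that is what a supremum preserves. *)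
Lemma cvg_diam0 (A : nat -> set X) :
  (\forall k \near \oo, A k !=set0) ->
  (forall e : R, (0 < e)%R -> \forall k \near \oo,
    forall x y, A k x -> A k y -> (mdist x y <= e)%R) ->
  diam (A k) @[k --> \oo] --> 0.
Proof.
move=> An0 Ae.
have dAe (e : R) : (0 < e)%R -> \forall k \near \oo, 0 <= diam (A k) <= e%:E.
  move=> /Ae; apply: filterS2 An0 => k Ak0 Ake; rewrite diam_ge0 //=.
  apply: ge_ereal_sup => _ [[x y] [/= Ax Ay] <-].
  by rewrite lee_fin; exact: Ake.
(* Convergence of extended reals reduces to that of reals once the diameters are eventually finite,
   which the bound for [e = 1] ensures. *)
apply/fine_cvgP; split.
  apply: filterS (dAe 1%R ltr01) => k /andP[d0 d1].
  by rewrite ge0_fin_numE // (le_lt_trans d1) // ltry.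
apply/cvgrPdist_le => e e0; apply: filterS (dAe e e0) => k /andP[d0 d1].
have dfin : diam (A k) \is a fin_num.
  by rewrite ge0_fin_numE // (le_lt_trans d1) // ltry.
by rewrite /= sub0r normrN ger0_norm ?fine_ge0 // -lee_fin fineK.
Qed.

End Diameter.

(** * Multifunctions induced by a continuous map of limits *)

Section FactorThroughFibers.
Context {R : realType} {X Y : nat -> metricType R}.
Context (f : forall l, X l.+1 -> X l) (g : forall l, Y l.+1 -> Y l).
Hypothesis X_compact : forall l, compact [set: X l].
Hypothesis f_continuous : forall l, continuous (@f l).
Hypothesis f_surjective : forall l, set_surj [set: X l.+1] [set: X l] (@f l).
Context (h : inverse_limit f -> inverse_limit g).
Hypothesis h_continuous : continuous h.

Let limX_compact : compact [set: inverse_limit f].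
Proof. by apply: inverse_limit_compact => // l; exact: metric_hausdorff. Qed.

Definition fiber_image k (z : X k) : set (Y k) :=
  [set inverse_limit_proj k (h x) | x in [set x | inverse_limit_proj k x = z]].

(** On the limit, g_{j,k} after p_k is p_j. This removes the bond and turns (b) and (c) into claims
    about fibers of p_k. *)
Lemma bond_fiber_image j k (jk : (j <= k)%N) (z : X k) :
  bond_image g j (fiber_image z) =
  [set inverse_limit_proj j (h x) | x in [set x | inverse_limit_proj k x = z]].
Proof.
rewrite (bond_imageE g jk); apply/seteqP; split.
  by move=> _ [_ [x xz <-] <-]; exists x => //; rewrite bond_inverse_limit_proj.
move=> _ [x xz <-]; exists (inverse_limit_proj k (h x)); first by exists x.
exact: bond_inverse_limit_proj.
Qed.

Lemma proj_comp_continuous k : continuous (fun x => inverse_limit_proj k (h x)).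
Proof.
by move=> x; apply: continuous_comp;
  [exact: h_continuous|exact: inverse_limit_proj_continuous].
Qed.

Lemma fiber_closed k (z : X k) :
  closed [set x : inverse_limit f | inverse_limit_proj k x = z].
Proof.
apply: (@closed_coincidence _ (X k) _ (fun=> z)).
- exact: metric_hausdorff.
- exact: inverse_limit_proj_continuous.
- exact: cst_continuous.
Qed.

Lemma closed_image_limit (Z : metricType R) (u : inverse_limit f -> Z) C :
  continuous u -> closed C -> closed (u @` C).
Proof.
move=> cu C_closed; apply: compact_closed; first exact: metric_hausdorff.
apply: continuous_compact; first exact: continuous_subspaceT.
exact: subclosed_compact limX_compact _.
Qed.

Lemma fiber_image_usc k : upper_semicontinuous (@fiber_image k).
Proof.
split=> [z|V V_open].
  split; last first.
    apply: closed_image_limit; first exact: proj_comp_continuous.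
    exact: fiber_closed.
  have [x xz] := inverse_limit_proj_surj f_surjective z.
  by exists (inverse_limit_proj k (h x)), x.
(* The z whose fiber image leaves [V] form the projection of the closed set [C], which is closed by
   compactness of the limit. *)
pose C := [set x | ~ V (inverse_limit_proj k (h x))].
rewrite (_ : [set z | _] = ~` (inverse_limit_proj k @` C)); last first.
  apply/seteqP; split=> [z zV [x Cx xz]|z zC _ [x xz <-]].
    by apply: Cx; apply: zV; exists x.
  by apply: contrapT => nV; apply: zC; exists x.
apply: closed_openC; apply: closed_image_limit.
  exact: inverse_limit_proj_continuous.
rewrite (_ : C = ~` ((fun x => inverse_limit_proj k (h x)) @^-1` V)) //.
apply: open_closedC.
by apply: open_comp => // x _; exact: proj_comp_continuous.
Qed.

Lemma diam_fiber_image j (x : inverse_limit f) :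
  diam (bond_image g j (fiber_image (inverse_limit_proj k x)))
    @[k --> \oo] --> 0%E.
Proof.
apply: cvg_diam0.
  exists j => // k /= jk; rewrite bond_fiber_image //.
  by exists (inverse_limit_proj j (h x)), x.
move=> e e0; have e2 : (0 < e / 2)%R by rewrite divr_gt0.
pose U := (fun x' => inverse_limit_proj j (h x')) @^-1`
  (ball (inverse_limit_proj j (h x)) (e / 2))°.
have U_open : open U.
  apply: open_comp; last exact: open_interior.
  by move=> x' _; exact: proj_comp_continuous.
have U_ball x' : U x' ->
    (mdist (inverse_limit_proj j (h x))
       (inverse_limit_proj j (h x')) < e / 2)%R.
  by move=> /interior_subset; rewrite ballEmdist.
(* The fibers through x shrink to x: a common point of all the C k would have
   the same coordinates as x but lie outside the neighborhood U of x. *)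
pose C k := [set x' : inverse_limit f |
  inverse_limit_proj k x' = inverse_limit_proj k x] `&` ~` U.
have [k Ck0] : exists k, C k = set0.
  apply: contrapT => /forallNP C0.
  have [|||x' Cx'] := @nested_closed_nonempty _ C limX_compact.
  - by move=> k; apply: closedI; [exact: fiber_closed|exact: open_closedC].
  - by move=> k; apply/set0P/eqP; exact: C0.
  - move=> k x' [xx' nU]; split=> //=.
    by rewrite -(inverse_limit_projS k x') -(inverse_limit_projS k x) xx'.
  have xx' : x' = x by apply: inverse_limit_eq => k; have [] := Cx' k I.
  have [_] := Cx' 0%N I; apply; rewrite /U /= xx'.
  by apply: nbhs_singleton; apply: nbhs_interior; exact: nbhsx_ballx.
(* [j <= l] removes the bond; [k <= l] puts the fiber of p_l through [x] inside that of p_k, hence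
   inside [U] as [C k] is empty. *)
exists (maxn j k) => // l /=; rewrite geq_max => /andP[jl kl].
have fibU x' : inverse_limit_proj l x' = inverse_limit_proj l x -> U x'.
  move=> xx'; apply: contrapT => nU; suff : C k x' by rewrite Ck0.
  by split=> //=; rewrite -!(bond_inverse_limit_proj kl) xx'.
rewrite bond_fiber_image //.
move=> _ _ [x1 /fibU/U_ball Ux1 <-] [x2 /fibU/U_ball Ux2 <-].
apply: le_trans (metric_triangle _ (inverse_limit_proj j (h x)) _) _.
by rewrite metric_sym (splitr e) lerD // ltW.
Qed.

End FactorThroughFibers.

(** * From multifunctions to a continuous surjection *)

Section LimitOfMultifunctions.
Context {R : realType} {X Y : nat -> metricType R}.
Context (f : forall l, X l.+1 -> X l) (g : forall l, Y l.+1 -> Y l).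
Hypothesis X_compact : forall l, compact [set: X l].
Hypothesis Y_compact : forall l, compact [set: Y l].
Hypothesis f_continuous : forall l, continuous (@f l).
Hypothesis g_continuous : forall l, continuous (@g l).
Hypothesis f_surjective : forall l, set_surj [set: X l.+1] [set: X l] (@f l).
Context (n m : nat -> nat) (m_leS : forall k, (m k <= m k.+1)%N).
Context (H : forall k, X (m k) -> set (Y (n k))).
Arguments H : clear implicits.
Hypothesis n_ltS : forall k, (n k < n k.+1)%N.
Hypothesis H_usc : forall k, upper_semicontinuous (@H k).
Hypothesis H_surj : forall k, surjective_graph (@H k).
Hypothesis H_nested : forall k j, (j <= n k)%N ->
  forall r (k_lt_r : (k < r)%N) (x : X (m r)),
    bond_image g j (H r x) `<=`
    bond_image g j (H k (bond f (leq_of_leqS m_leS (ltnW k_lt_r)) x)).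
Hypothesis H_diam : forall j (x : inverse_limit f),
  diam (bond_image g j (H k (inverse_limit_proj (m k) x)))
    @[k --> \oo] --> 0%E.

Let approx j (x : inverse_limit f) k : set (Y j) :=
  bond_image g j (H k (inverse_limit_proj (m k) x)).
Arguments approx : clear implicits.

(** Supplies indices k with j <= n_k: every k >= j is one, such as [maxn j N] below. *)
Lemma leq_index k : (k <= n k)%N.
Proof. by elim: k => // k IH; exact: leq_ltn_trans IH (n_ltS k). Qed.

Lemma approx_closed j x k : (j <= n k)%N -> closed (approx j x k).
Proof.
move=> jk; rewrite /approx (bond_imageE g jk).
apply: compact_closed; first exact: metric_hausdorff.
apply: continuous_compact.
  by apply: continuous_subspaceT; exact: bond_continuous.
have [_ HC] := (H_usc k).1 (inverse_limit_proj (m k) x).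
exact: subclosed_compact (@Y_compact (n k)) _.
Qed.

Lemma approx_nonempty j x k : (j <= n k)%N -> approx j x k !=set0.
Proof.
move=> jk; have [[y Hy] _] := (H_usc k).1 (inverse_limit_proj (m k) x).
by rewrite /approx (bond_imageE g jk); exists (bond g jk y), y.
Qed.

Lemma approx_le j x k r : (j <= n k)%N -> (k <= r)%N ->
  approx j x r `<=` approx j x k.
Proof.
move=> jk; rewrite leq_eqVlt => /predU1P[<-//|kr].
have := H_nested jk kr (x := inverse_limit_proj (m r) x).
by rewrite bond_inverse_limit_proj.
Qed.

(** If y and z differ, their distance can serve as tolerance in (c), and at a late index it would be
    smaller than itself. *)
Lemma approx_inter_unique j x (y z : Y j) :
  (forall k, (j <= n k)%N -> approx j x k y) ->
  (forall k, (j <= n k)%N -> approx j x k z) -> y = z.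
Proof.
move=> Ky Kz; apply/eqP; apply: contrapT => /negP; rewrite -mdist_gt0 => yz.
have [N _ KN] := cvg_diam0P (@H_diam j x) yz.
have jN : (j <= n (maxn j N))%N.
  by rewrite (leq_trans _ (leq_index _)) ?leq_maxl.
by have := KN (maxn j N) (leq_maxr _ _) y z (Ky _ jN) (Kz _ jN); rewrite ltxx.
Qed.

Lemma approx_inter_nonempty j x :
  exists y, forall k, (j <= n k)%N -> approx j x k y.
Proof.
(* The sequence starts at index j so that j <= n_{j+d} for all d; for j > n_k the set [approx j x k]
   is empty. *)
have jd d : (j <= n (j + d))%N by rewrite (leq_trans _ (leq_index _)) ?leq_addr.
have [|||y Ky] := @nested_closed_nonempty _
  (fun d => approx j x (j + d)) (@Y_compact j).
- by move=> d; exact: approx_closed.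
- by move=> d; exact: approx_nonempty.
- by move=> d; rewrite addnS; exact: approx_le.
exists y => k jk; apply: (@approx_le _ _ _ (j + k)) => //.
  exact: leq_addl.
exact: Ky.
Qed.

Lemma approx_inter_limit x :
  exists y : inverse_limit g,
    forall j k, (j <= n k)%N -> approx j x k (inverse_limit_proj j y).
Proof.
pose y j := sval (cid (approx_inter_nonempty j x)).
have Ky j : forall k, (j <= n k)%N -> approx j x k (y j).
  by rewrite /y; case: cid.
suff ylim : inverse_limit g y by exists (SigSub (mem_set ylim)).
(* By uniqueness it suffices that g(y_{j+1}) lies in every approximation of y_j. The passage to k+1
   matters: j <= n_k yields j+1 <= n_{k+1}, but not j+1 <= n_k. *)
move=> j; apply: approx_inter_unique (Ky j) _ => k jk.
apply: (approx_le jk (leqnSn k)).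
have jk1 : (j < n k.+1)%N by exact: leq_ltn_trans jk (n_ltS k).
have := Ky j.+1 k.+1 jk1.
rewrite /approx (bond_imageE g jk1) (bond_imageE g (ltnW jk1)) => -[z Hz <-].
by exists z => //; rewrite f_bond.
Qed.

Let h x := sval (cid (approx_inter_limit x)).

Let approx_h x j k : (j <= n k)%N -> approx j x k (inverse_limit_proj j (h x)).
Proof. by rewrite /h; case: cid => y Ky; exact: Ky. Qed.

Let h_continuous : continuous h.
Proof.
apply: continuous_inverse_limit => j x V /nbhs_interior.
move=> /metricType_numDomainType.nbhs_mdistP[e /= e0 eV].
have [N _ KN] := cvg_diam0P (@H_diam j x) e0.
pose k := maxn j N.
have jk : (j <= n k)%N by rewrite (leq_trans _ (leq_index _)) ?leq_maxl.
(* Upper semicontinuity keeps g_{j,n_k}(H_k) inside the interior of [V] near [x], and the j-th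
   coordinate of h(x') lies in that set. *)
pose O := [set z | H k z `<=` bond g jk @^-1` V°].
have O_open : open O.
  apply: (H_usc k).2; apply: open_comp; last exact: open_interior.
  by move=> y _; exact: bond_continuous.
have Ox : O (inverse_limit_proj (m k) x).
  move=> y Hy; apply: eV => /=; apply: (KN k); first exact: leq_maxr.
    exact: approx_h.
  by rewrite (bond_imageE g jk); exists y.
have O_nbhs : nbhs x (inverse_limit_proj (m k) @^-1` O).
  by apply: inverse_limit_proj_continuous; exact: open_nbhs_nbhs.
apply: filterS O_nbhs => x' Ox'.
have := approx_h x' jk; rewrite /approx (bond_imageE g jk) => -[y Hy yE].
by have := Ox' y Hy; rewrite /= yE; exact: interior_subset.
Qed.

Let h_surj : set_surj [set: inverse_limit f] [set: inverse_limit g] h.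
Proof.
move=> y _; pose A k := [set x : inverse_limit f |
  H k (inverse_limit_proj (m k) x) (inverse_limit_proj (n k) y)].
have [||||x Ax] := @nested_closed_nonempty _ A.
- by apply: inverse_limit_compact => // l; exact: metric_hausdorff.
(* The complement of [A k] is the set of x for which H_k(p_{m_k}(x)) avoids y_{n_k}; it is open by
   upper semicontinuity, applied to the complement of a point. *)
- move=> k; rewrite (_ : A k = ~` (inverse_limit_proj (m k) @^-1`
      [set z | H k z `<=` ~` [set inverse_limit_proj (n k) y]])); last first.
    apply/seteqP; split=> [x /= Hx HC|x /= nH]; first exact: HC Hx erefl.
    apply: contrapT => nA; apply: nH => z Hz zy; apply: nA.
    by rewrite /A /= -zy.
  apply: open_closedC; apply: open_comp.
    by move=> x _; exact: inverse_limit_proj_continuous.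
  apply: (H_usc k).2; apply: closed_openC.
  by apply: compact_closed; [exact: metric_hausdorff|exact: compact_set1].
- move=> k; have : [set: Y (n k)] (inverse_limit_proj (n k) y) by [].
  rewrite -(H_surj k) => -[z _ Hz].
  have [x xz] := inverse_limit_proj_surj f_surjective z.
  by exists x; rewrite /A /= xz.
(* Bonding y_{n_{k+1}} down to y_{n_k} puts the latter in the image of H_{k+1}; (b) with j = n_k
   then moves it into H_k. *)
- move=> k x Ax; have kk1 := ltnW (n_ltS k).
  have : approx (n k) x k.+1 (inverse_limit_proj (n k) y).
    rewrite /approx (bond_imageE g kk1).
    exists (inverse_limit_proj (n k.+1) y) => //.
    exact: bond_inverse_limit_proj.
  move=> /(approx_le (leqnn _) (leqnSn k)).
  rewrite /approx (bond_imageE g (leqnn _)).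
  by move=> [z Hz]; rewrite bondnn /A /= => <-.
(* The j-th coordinates of h(x) and y lie in the same shrinking sets, so they agree. *)
exists x => //; apply: inverse_limit_eq => j.
apply: approx_inter_unique => [k|k] jk.
  exact: approx_h.
rewrite /approx (bond_imageE g jk); exists (inverse_limit_proj (n k) y).
  exact: Ax.
exact: bond_inverse_limit_proj.
Qed.

Lemma exists_continuous_surjection :
  exists h : inverse_limit f -> inverse_limit g,
    continuous h /\ set_surj [set: inverse_limit f] [set: inverse_limit g] h.
Proof. by exists h; split; [exact: h_continuous|exact: h_surj]. Qed.

End LimitOfMultifunctions.

(** * Both implications combined *)

Theorem corollary4p6 (R : realType) (X Y : nat -> metricType R)
    (f : forall l, X l.+1 -> X l) (g : forall l, Y l.+1 -> Y l)
    (X_compact : forall l, compact [set: X l])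
    (Y_compact : forall l, compact [set: Y l])
    (f_continuous : forall l, continuous (@f l))
    (g_continuous : forall l, continuous (@g l))
    (f_surjective : forall l, set_surj [set: X l.+1] [set: X l] (@f l))
    (g_surjective : forall l, set_surj [set: Y l.+1] [set: Y l] (@g l)) :
  (exists h : inverse_limit f -> inverse_limit g,
      continuous h /\ set_surj [set: inverse_limit f] [set: inverse_limit g] h)
  <->
  (exists (n m : nat -> nat) (m_leS : forall k, (m k <= m k.+1)%N)
      (H : forall k, X (m k) -> set (Y (n k))),
      (forall k, (n k < n k.+1)%N) /\
      (forall k, (n k <= m k)%N) /\
      (forall k, upper_semicontinuous (@H k)) /\
      (forall k, surjective_graph (@H k)) /\
      (forall k j, (j <= n k)%N ->
        forall r (k_lt_r : (k < r)%N) (x : X (m r)),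
          bond_image g j (H r x) `<=`
          bond_image g j (H k (bond f (leq_of_leqS m_leS (ltnW k_lt_r)) x))) /\
      (forall j (x : inverse_limit f),
        diam (bond_image g j (H k (inverse_limit_proj (m k) x)))
          @[k --> \oo] --> 0%E)).
Proof.
split=> [[h [h_cont h_surj]]|]; last first.
  move=> [n [m [m_leS [H [n_ltS [_ [Husc [Hsurj [Hnest Hdiam]]]]]]]]].
  exact: (exists_continuous_surjection X_compact Y_compact f_continuous
    g_continuous f_surjective n_ltS Husc Hsurj Hnest Hdiam).
exists id, id, (fun k => leqnSn k), (fun k => @fiber_image _ _ _ f g h k).
split=> //; split=> //; split; first by move=> k; exact: fiber_image_usc.
split.
  move=> k; apply/seteqP; split=> // y _.
  (* The point y extends to a thread, which lifts through [h]; the k-th coordinate of the lift is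
     the witness. *)
  have [y' <-] := inverse_limit_proj_surj g_surjective y.
  have [x _ <-] := h_surj y' I.
  by exists (inverse_limit_proj k x) => //; exists x.
split; last by move=> j x; exact: diam_fiber_image.
(* A thread with r-th coordinate x has k-th coordinate f_{k,r}(x), so the fiber at r lies in the
   fiber at k. *)
move=> k j jk r kr x; rewrite !bond_fiber_image //; last first.
  exact: leq_trans jk (ltnW kr).
by move=> _ [x' <- <-]; exists x' => //=; rewrite bond_inverse_limit_proj.
Qed.
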